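(* Let $n\ge2$, $m\in\mathbb{Z}$, $r\in\mathbb{N}$ with $\gcd(n,r!\cdot m)=1$. For $1\le l\le r$ put $a_{r,l}:=\binom{r}{l}(-1)^l$ and $b_{r,l,n}:=\binom{r}{l}\frac{(n-1)^l-(-1)^l}{n}$ (an integer), and $$K_{n,m,r}(s,q):=\prod_{l=1}^r\Big(\frac{1-s}{1-q^{lm}s}\Big)^{a_{r,l}+b_{r,l,n}}.$$ Then $$\zeta(s,\sigma_{n,m};\beta_{n,q}^{\otimes r})=K_{n,m,r}(s,q)\cdot\prod_{l=1}^r\zeta(s,\sigma_{n,lm};\beta_{n,q})^{b_{r,l,n}}.$$
   Context: $\sigma_{n,m}:=(\sigma_1\cdots\sigma_{n-1})^m\in\mathrm{B}_n$ (braid group with standard generators $\sigma_i$). The Burau representation $\beta_{n,q}$ is given by $\beta_{n,q}(\sigma_i)=I_{i-1}\oplus\begin{pmatrix}1-q&1\\ q&0\end{pmatrix}\oplus I_{n-i-1}$ over $\mathbb{Z}[q^{\pm1}]$, and $\zeta(s,\sigma;\beta_{n,q}):=\det(I_n-\beta_{n,q}(\sigma)s)^{-1}$. For $r\ge1$, $\zeta(s,\sigma;\beta_{n,q}^{\otimes r}):=\det(I_{n^r}-\beta_{n,q}(\sigma)^{\otimes r}s)^{-1}$, where $\otimes$ is the Kronecker tensor product of matrices. *)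

(* Defs.v *)
From HB Require Import structures.
From mathcomp Require Import all_boot all_order all_algebra.
Set Implicit Arguments. Unset Strict Implicit. Unset Printing Implicit Defensive.
Import Order.TTheory GRing.Theory Num.Theory.
Local Open Scope ring_scope.

Lemma kron_div_lt (a b : nat) (i : 'I_(a * b)) : (i %/ b < a)%N.
Proof.
case: b i => [|b] i; first by case: i => k; rewrite muln0.
by rewrite ltn_divLR // mulnC; case: i.
Qed.

Lemma kron_mod_lt (a b : nat) (i : 'I_(a * b)) : (i %% b < b)%N.
Proof.
case: b i => [|b] i; first by case: i => k; rewrite muln0.
by rewrite ltn_pmod.
Qed.

(* row index i = i1 * m2 + i2, column index j = j1 * n2 + j2 *)
Definition kron (R : pzRingType) (m1 n1 m2 n2 : nat)
    (A : 'M[R]_(m1, n1)) (B : 'M[R]_(m2, n2)) : 'M[R]_(m1 * m2, n1 * n2) :=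
  \matrix_(i < m1 * m2, j < n1 * n2)
     (A (Ordinal (kron_div_lt i)) (Ordinal (kron_div_lt j)) *
      B (Ordinal (kron_mod_lt i)) (Ordinal (kron_mod_lt j))).

Fixpoint kron_pow (R : pzRingType) (n : nat) (A : 'M[R]_n) (r : nat)
    : 'M[R]_(n ^ r) :=
  match r return 'M[R]_(n ^ r) with
  | 0 => castmx (esym (expn0 n), esym (expn0 n)) (1%:M : 'M[R]_1)
  | r'.+1 => castmx (esym (expnS n r'), esym (expnS n r'))
                    (kron A (kron_pow A r'))
  end.

(* beta_{n,q}(sigma_{i+1}) for i : nat, 0-indexed block position i
   (i.e. sigma_{i+1} = I_i (+) [[1-q,1],[q,0]] (+) I_{n-i-2}). *)
Definition burau_gen (R : pzRingType) (n : nat) (q : R) (i : nat) : 'M[R]_n :=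
  \matrix_(j < n, k < n)
    if (j == i :> nat) && (k == i :> nat) then 1 - q
    else if (j == i :> nat) && (k == i.+1 :> nat) then 1
    else if (j == i.+1 :> nat) && (k == i :> nat) then q
    else if (j == i.+1 :> nat) && (k == i.+1 :> nat) then 0
    else if j == k then 1 else 0.

Definition burau_delta (R : pzRingType) (n : nat) (q : R) : 'M[R]_n :=
  \prod_(i < n.-1) burau_gen n q i.

Definition mx_powz (R : comUnitRingType) (n : nat) (A : 'M[R]_n) (m : int)
    : 'M[R]_n :=
  match m with
  | Posz k => A ^+ k
  | Negz k => (invmx A) ^+ k.+1
  end.

Definition burau_sigma (R : comUnitRingType) (n : nat) (q : R) (m : int)
    : 'M[R]_n :=
  mx_powz (burau_delta n q) m.

Definition zeta (R : comUnitRingType) (d : nat) (s : R) (A : 'M[R]_d) : R :=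
  (\det (1%:M - s *: A))^-1.

Definition a_coef (r l : nat) : int := ('C(r, l))%:Z * (-1) ^+ l.
Definition b_coef (r l n : nat) : int :=
  ('C(r, l))%:Z * ((((n%:Z - 1) ^+ l - (-1) ^+ l) %/ n%:Z)%Z).

Definition K_fun (F : fieldType) (n : nat) (m : int) (r : nat) (s q : F) : F :=
  \prod_(1 <= l < r.+1)
     ((1 - s) / (1 - q ^ (l%:Z * m) * s)) ^ (a_coef r l + b_coef r l n).

(* Main.v *)
(** Let [P] be the cyclic shift of [e_0, ..., e_{n-1}] and [1^T] the all-ones
    row.  The product of the Burau generators is [q P + (1-q) e_0 1^T], and
    [1^T] is fixed by it, so its [m]-th power preserves the sum-zero hyperplane,
    acts trivially on the quotient, and acts on the hyperplane as [t V] with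
    [t = q^m] and [V] the restriction of [P^m].  Splitting the tensor factors one
    at a time,
      [det (1 - s M^{(x)r}) = \prod_l h_l (t^l s) ^ C(r,l)]
    with [h_l c = det (1 - c V^{(x)l})].  Since [P^m] has the same
    block triangular shape with [t = 1], [h_{l+1} c * h_l c] is
    [det (1 - c P^m (x) V^{(x)l})].  Here [P^m] is conjugate to [P] because [m]
    is prime to [n], and [det (1 - P (x) B) = det (1 - B^n)].  As [V^n = 1], this gives
      [h_{l+1} c * h_l c = (1 - c^n) ^ ((n-1)^l)],
    whence [h_l c = (1 - c)^((-1)^l) (1 - c^n)^(((n-1)^l - (-1)^l) / n)].
    This avoids eigenvalues, so it also covers characteristics dividing [n]. *)
Require Import Defs.
From HB Require Import structures.
From mathcomp Require Import all_boot all_order all_algebra.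
From mathcomp Require Import ring zify.
Import Order.TTheory GRing.Theory Num.Theory.
Local Open Scope ring_scope.

(** * Kronecker products and determinants of the form [det (1 - s A)] *)

Section Kronecker.
Set Implicit Arguments.
Unset Strict Implicit.
Unset Printing Implicit Defensive.
Variable R : comNzRingType.

Lemma kron_index_bij (m n : nat) :
  bijective (fun i : 'I_(m * n) =>
    (Ordinal (kron_div_lt i), Ordinal (kron_mod_lt i))).
Proof.
apply: inj_card_bij; last by rewrite card_prod !card_ord.
by move=> i j [ed em]; apply/val_inj; rewrite /= (divn_eq i n) ed em -divn_eq.
Qed.

Lemma sum_kron_index (m n : nat) (F : 'I_m -> 'I_n -> R) :
  \sum_(i < m * n) F (Ordinal (kron_div_lt i)) (Ordinal (kron_mod_lt i))
  = \sum_i \sum_j F i j.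
Proof.
rewrite pair_big /= [RHS](reindex _ (onW_bij _ (kron_index_bij m n))).
exact: eq_bigr.
Qed.

Lemma mul_kron (m1 n1 p1 m2 n2 p2 : nat) (A : 'M[R]_(m1, n1)) (B : 'M[R]_(m2, n2))
    (C : 'M[R]_(n1, p1)) (D : 'M[R]_(n2, p2)) :
  kron A B *m kron C D = kron (A *m C) (B *m D).
Proof.
apply/matrixP => i j; rewrite !mxE.
under eq_bigr do rewrite !mxE.
rewrite (sum_kron_index (fun k l => A (Ordinal (kron_div_lt i)) k
  * B (Ordinal (kron_mod_lt i)) l
  * (C k (Ordinal (kron_div_lt j)) * D l (Ordinal (kron_mod_lt j))))).
rewrite big_distrlr /=; apply: eq_bigr => k _; apply: eq_bigr => l _; ring.
Qed.

Lemma kron1 (m n : nat) : kron (1%:M : 'M[R]_m) (1%:M : 'M[R]_n) = 1%:M.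
Proof.
apply/matrixP => i j; rewrite !mxE -natrM mulnb; congr (_%:R).
by have /bij_inj/inj_eq <- := kron_index_bij m n.
Qed.

Lemma kronDl (m1 n1 m2 n2 : nat) (A B : 'M[R]_(m1, n1)) (C : 'M[R]_(m2, n2)) :
  kron (A + B) C = kron A C + kron B C.
Proof. by apply/matrixP => i j; rewrite !mxE mulrDl. Qed.

Lemma kronDr (m1 n1 m2 n2 : nat) (A : 'M[R]_(m1, n1)) (B C : 'M[R]_(m2, n2)) :
  kron A (B + C) = kron A B + kron A C.
Proof. by apply/matrixP => i j; rewrite !mxE mulrDr. Qed.

Lemma kronZl (m1 n1 m2 n2 : nat) (a : R) (A : 'M[R]_(m1, n1)) (B : 'M[R]_(m2, n2)) :
  kron (a *: A) B = a *: kron A B.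
Proof. by apply/matrixP => i j; rewrite !mxE mulrA. Qed.

Lemma kronZr (m1 n1 m2 n2 : nat) (a : R) (A : 'M[R]_(m1, n1)) (B : 'M[R]_(m2, n2)) :
  kron A (a *: B) = a *: kron A B.
Proof. by apply/matrixP => i j; rewrite !mxE mulrCA. Qed.

Lemma kron0l (m1 n1 m2 n2 : nat) (B : 'M[R]_(m2, n2)) :
  kron (0 : 'M[R]_(m1, n1)) B = 0.
Proof. by apply/matrixP => i j; rewrite !mxE mul0r. Qed.

Lemma kron0r (m1 n1 m2 n2 : nat) (A : 'M[R]_(m1, n1)) :
  kron A (0 : 'M[R]_(m2, n2)) = 0.
Proof. by apply/matrixP => i j; rewrite !mxE mulr0. Qed.

Lemma kron1l_cast (n : nat) (A : 'M[R]_n) :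
  kron (1%:M : 'M[R]_1) A = castmx (esym (mul1n n), esym (mul1n n)) A.
Proof.
apply/matrixP => i j; rewrite castmxE !mxE !ord1 eqxx mul1r.
by congr (A _ _); apply/val_inj; rewrite /= modn_small // -[X in (_ < X)%N]mul1n.
Qed.

Lemma kron1r_cast (n : nat) (A : 'M[R]_n) :
  kron A (1%:M : 'M[R]_1) = castmx (esym (muln1 n), esym (muln1 n)) A.
Proof.
apply/matrixP => i j; rewrite castmxE !mxE !ord1 eqxx mulr1.
by congr (A _ _); apply/val_inj; rewrite /= divn1.
Qed.

Lemma kronX (m n : nat) (A : 'M[R]_m) (B : 'M[R]_n) (k : nat) :
  kron A B ^+ k = kron (A ^+ k) (B ^+ k).
Proof.
elim: k => [|k IHk]; first by rewrite !expr0 kron1.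
by rewrite !exprS IHk; apply: mul_kron.
Qed.

Lemma det_1B_cast (n n' : nat) (e : n = n') (s : R) (A : 'M[R]_n) :
  \det (1%:M - s *: castmx (e, e) A) = \det (1%:M - s *: A).
Proof. by case: n' / e; rewrite castmx_id. Qed.

(** Sylvester's identity, by taking determinants of the two block triangular factorisations of
    [block_mx 1 A B 1]. It later performs changes of basis through rectangular factors. *)
Lemma det_1B_mulC (m n : nat) (A : 'M[R]_(m, n)) (B : 'M[R]_(n, m)) :
  \det (1%:M - A *m B) = \det (1%:M - B *m A).
Proof.
have e1 : block_mx 1%:M A B 1%:M
    = block_mx 1%:M 0 B 1%:M *m block_mx 1%:M A 0 (1%:M - B *m A).
  by rewrite mulmx_block !mul1mx !mul0mx !mulmx1 !addr0 addrC subrK.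
have e2 : block_mx 1%:M A B 1%:M
    = block_mx (1%:M - A *m B) A 0 1%:M *m block_mx 1%:M 0 B 1%:M.
  by rewrite mulmx_block !mul1mx !mul0mx !mulmx1 mulmx0 !add0r subrK.
have := congr1 determinant e1; rewrite e2 !det_mulmx !det_ublock !det_lblock !det1.
by rewrite !mul1r !mulr1.
Qed.

(* [X] is conjugate to a block triangular matrix with diagonal blocks [Y] and
   [Z]; the change of basis [row_mx i p], with inverse [col_mx u v], is kept
   in separate pieces so that it can be tensored without reindexing. *)
Definition extension (d d1 d2 : nat)
    (X : 'M[R]_d) (Y : 'M[R]_d1) (Z : 'M[R]_d2) :=
  exists (i : 'M[R]_(d, d1)) (p : 'M[R]_(d, d2))
         (u : 'M[R]_(d1, d)) (v : 'M[R]_(d2, d)),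
  [/\ [/\ i *m u + p *m v = 1%:M, u *m i = 1%:M, v *m p = 1%:M,
          u *m p = 0 & v *m i = 0],
      v *m X *m i = 0, u *m X *m i = Y & v *m X *m p = Z].

Lemma extension_det (d d1 d2 : nat) (X : 'M[R]_d) (Y : 'M[R]_d1) (Z : 'M[R]_d2)
    (s : R) :
  extension X Y Z ->
  \det (1%:M - s *: X) = \det (1%:M - s *: Y) * \det (1%:M - s *: Z).
Proof.
case=> [i [p [u [v [[iu _ _ _ _] vXi uXi vXp]]]]].
(* Inserting [row_mx i p *m col_mx u v = 1] and applying Sylvester's identity conjugates [X] without
   identifying [d] with [d1 + d2]. *)
have -> : s *: X = row_mx i p *m (col_mx u v *m (s *: X)).
  by rewrite mulmxA mul_row_col iu mul1mx.
rewrite det_1B_mulC mul_col_mx mul_col_row -!scalemxAr -!scalemxAl vXi uXi vXp.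
by rewrite scaler0 scalar_mx_block opp_block_mx add_block_mx oppr0 addr0 det_ublock.
Qed.

Lemma extension_kronl (n d d1 d2 : nat) (A : 'M[R]_n)
    (X : 'M[R]_d) (Y : 'M[R]_d1) (Z : 'M[R]_d2) :
  extension X Y Z ->
  extension (kron A X) (kron A Y) (kron A Z).
Proof.
case=> [i [p [u [v [[iu ui vp up vi] vXi uXi vXp]]]]].
exists (kron 1%:M i), (kron 1%:M p), (kron 1%:M u), (kron 1%:M v).
by rewrite !mul_kron -kronDr !mul1mx !mulmx1 iu ui vp up vi vXi uXi vXp !kron1 !kron0r.
Qed.

Lemma extension_kronr (n d d1 d2 : nat) (A : 'M[R]_n)
    (X : 'M[R]_d) (Y : 'M[R]_d1) (Z : 'M[R]_d2) :
  extension X Y Z ->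
  extension (kron X A) (kron Y A) (kron Z A).
Proof.
case=> [i [p [u [v [[iu ui vp up vi] vXi uXi vXp]]]]].
exists (kron i 1%:M), (kron p 1%:M), (kron u 1%:M), (kron v 1%:M).
by rewrite !mul_kron -kronDl !mul1mx !mulmx1 iu ui vp up vi vXi uXi vXp !kron1 !kron0l.
Qed.

Lemma extension_castl (d d' d1 d2 : nat) (e : d = d')
    (X : 'M[R]_d) (Y : 'M[R]_d1) (Z : 'M[R]_d2) :
  extension X Y Z -> extension (castmx (e, e) X) Y Z.
Proof. by case: d' / e; rewrite castmx_id. Qed.

Lemma extension_castr (d d1 d2 d' : nat) (e : d2 = d')
    (X : 'M[R]_d) (Y : 'M[R]_d1) (Z : 'M[R]_d2) :
  extension X Y (castmx (e, e) Z) -> extension X Y Z.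
Proof. by case: d' / e; rewrite castmx_id. Qed.

(** One tensor factor [M] is either replaced by [V] or dropped, the quotient being trivial: this is
    the single step behind Pascal's rule below. *)
Lemma extension_kron1 (n k d : nat) (M : 'M[R]_n) (V : 'M[R]_k) (X : 'M[R]_d) :
  extension M V (1%:M : 'M[R]_1) -> extension (kron M X) (kron V X) X.
Proof.
move/(extension_kronr X); rewrite kron1l_cast; exact: extension_castr.
Qed.

Fixpoint kron_iter_dim (k j d : nat) : nat :=
  if j is j'.+1 then kron_iter_dim k j' (k * d) else d.

(* The new factor is added next to [B], not in front: [kron_iter V j.+1 B] is
   then convertible to [kron_iter V j (kron V B)], with no cast. *)
Fixpoint kron_iter (k : nat) (V : 'M[R]_k) (j d : nat) (B : 'M[R]_d) :
    'M[R]_(kron_iter_dim k j d) :=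
  match j return 'M[R]_(kron_iter_dim k j d) with
  | 0 => B
  | j'.+1 => kron_iter V j' (kron V B)
  end.

Lemma kron_iter_dimE (k j d : nat) : kron_iter_dim k j d = (k ^ j * d)%N.
Proof.
by elim: j d => [|j IHj] d /=; rewrite ?mul1n // IHj expnSr mulnA.
Qed.

Lemma kron_iterSr (k : nat) (V : 'M[R]_k) (j d : nat) (B : 'M[R]_d) :
  exists e, kron_iter V j.+1 B = castmx (e, e) (kron V (kron_iter V j B)).
Proof.
elim: j d B => [|j IHj] d B; first by exists erefl; rewrite castmx_id.
exact: IHj.
Qed.

Lemma kron_iter_scaler (k : nat) (V : 'M[R]_k) (j d : nat) (B : 'M[R]_d) (t : R) :
  kron_iter V j (t *: B) = t *: kron_iter V j B.
Proof. by elim: j d B => //= j IHj d B; rewrite kronZr IHj. Qed.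

Lemma kron_iter_scalel (k : nat) (V : 'M[R]_k) (j d : nat) (B : 'M[R]_d) (t : R) :
  kron_iter (t *: V) j B = t ^+ j *: kron_iter V j B.
Proof.
elim: j d B => [|j IHj] d B /=; first by rewrite scale1r.
by rewrite kronZl IHj kron_iter_scaler scalerA exprSr.
Qed.

Lemma kron_iterX (k : nat) (V : 'M[R]_k) (j d : nat) (B : 'M[R]_d) (i : nat) :
  kron_iter V j B ^+ i = kron_iter (V ^+ i) j (B ^+ i).
Proof. by elim: j d B => //= j IHj d B; rewrite IHj kronX. Qed.

Lemma kron_iter1 (k j d : nat) : kron_iter (1%:M : 'M[R]_k) j (1%:M : 'M[R]_d) = 1%:M.
Proof. by elim: j d => //= j IHj d; rewrite kron1. Qed.

Lemma extension_kron_iter (k : nat) (V : 'M[R]_k) (j d d1 d2 : nat)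
    (X : 'M[R]_d) (Y : 'M[R]_d1) (Z : 'M[R]_d2) :
  extension X Y Z ->
  extension (kron_iter V j X) (kron_iter V j Y) (kron_iter V j Z).
Proof.
elim: j d d1 d2 X Y Z => //= j IHj d d1 d2 X Y Z XYZ.
by apply: IHj; apply: extension_kronl.
Qed.

(* Pascal's rule: splitting one factor [M] of [V^{(x)j} (x) M^{(x)(r+1)}]
   gives [V^{(x)j} (x) M^{(x)r}] and [V^{(x)(j+1)} (x) M^{(x)r}]. *)
Lemma det_kron_pow (n k : nat) (M : 'M[R]_n) (V : 'M[R]_k) (s : R) (j r : nat) :
  extension M V (1%:M : 'M[R]_1) ->
  \det (1%:M - s *: kron_iter V j (kron_pow M r))
  = \prod_(i < r.+1) \det (1%:M - s *: kron_iter V (j + i) (1%:M : 'M[R]_1)) ^+ 'C(r, i).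
Proof.
move=> MV1; elim: r j => [|r IHr] j.
  by rewrite big_ord1 /= castmx_id addn0 expr1.
have /(extension_kron_iter V j) /extension_det -> :
    extension (kron_pow M r.+1) (kron V (kron_pow M r)) (kron_pow M r).
  exact/extension_castl/extension_kron1.
rewrite (IHr j.+1) IHr.
rewrite [X in _ * X]big_ord_recl [RHS]big_ord_recl !bin0 mulrCA; congr (_ * _).
under [RHS]eq_bigr do rewrite lift0 binS exprD.
(* The last factor has exponent ['C(r, r.+1) = 0]; without it, this product has the same [r] factors
   as the one left by the split-off [i = 0] term. *)
rewrite big_split /= [X in _ = X * _]big_ord_recr /= bin_small // expr0 mulr1 mulrC.
congr (_ * _); apply: eq_bigr => i _; by rewrite ?lift0 // addnS -addSn.
Qed.

End Kronecker.

(** * Cyclic shift matrices indexed by the integers modulo [N] *)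

Section Shift.
Set Implicit Arguments.
Unset Strict Implicit.
Unset Printing Implicit Defensive.
Variables (F : comNzRingType) (n : nat).
Local Notation N := n.+2.

(** Column [j] is the basis vector at [f j], so products follow composition in the same order. The
    size [n.+2] makes ['I_N] a ring: translations give the shifts, and multiplications by units
    conjugate them. *)
Definition fun_mx (f : 'I_N -> 'I_N) : 'M[F]_N := \matrix_(i, j) (i == f j)%:R.

Lemma mulmx_fun_mxE (m : nat) (A : 'M[F]_(m, N)) (f : 'I_N -> 'I_N) i j :
  (A *m fun_mx f) i j = A i (f j).
Proof.
rewrite mxE (bigD1 (f j)) //= mxE eqxx mulr1 big1 ?addr0 // => k kf.
by rewrite mxE (negPf kf) mulr0.
Qed.

Lemma mul_fun_mx (f g : 'I_N -> 'I_N) : fun_mx f *m fun_mx g = fun_mx (f \o g).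
Proof. by apply/matrixP => i j; rewrite mulmx_fun_mxE !mxE. Qed.

Lemma eq_fun_mx (f g : 'I_N -> 'I_N) : f =1 g -> fun_mx f = fun_mx g.
Proof. by move=> fg; apply/matrixP => i j; rewrite !mxE fg. Qed.

Lemma fun_mx_id : fun_mx id = 1%:M.
Proof. by apply/matrixP => i j; rewrite !mxE. Qed.

Definition shift_mx (a : 'I_N) : 'M[F]_N := fun_mx (+%R^~ a).

Lemma mul_shift_mx (a b : 'I_N) : shift_mx a *m shift_mx b = shift_mx (a + b).
Proof.
by rewrite mul_fun_mx; apply: eq_fun_mx => j /=; rewrite -addrA (addrC b).
Qed.

Lemma shift_mx0 : shift_mx 0 = 1%:M.
Proof. by rewrite -fun_mx_id; apply: eq_fun_mx => j; rewrite addr0. Qed.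

Lemma mul_const_shift_mx (m : nat) (c : F) (a : 'I_N) :
  (const_mx c : 'M_(m, N)) *m shift_mx a = const_mx c.
Proof. by apply/matrixP => i j; rewrite mulmx_fun_mxE !mxE. Qed.

Definition nilshift_mx : 'M[F]_N := \matrix_(i, j) (i == j.+1 :> nat)%:R.

Lemma nilshift_mxX (k : nat) :
  nilshift_mx ^+ k = \matrix_(i, j) (i == j + k :> nat)%N%:R.
Proof.
elim: k => [|k IHk]; first by apply/matrixP => i j; rewrite expr0 !mxE addn0.
rewrite exprSr IHk; apply/matrixP => i j; rewrite !mxE.
have [jN|jN] := ltnP j.+1 N.
  rewrite (bigD1 (Ordinal jN)) //= !mxE /= eqxx mulr1 addnS addSn big1 ?addr0 //.
  move=> l lj; rewrite !mxE (_ : (l == j.+1 :> nat) = false) ?mulr0 //.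
  by apply: contraNF lj => /eqP lj; apply/eqP/val_inj.
rewrite big1 => [|l _]; first by case: eqP => // ij; have := ltn_ord i; lia.
rewrite !mxE (_ : (l == j.+1 :> nat) = false) ?mulr0 //.
by have := ltn_ord l; lia.
Qed.

Lemma shift_mx1E :
  shift_mx 1 = nilshift_mx + delta_mx 0 (0 : 'I_1) *m delta_mx 0 ord_max.
Proof.
apply/matrixP => i j; rewrite mul_delta_mx !mxE -natrD; congr (_%:R).
rewrite -!(inj_eq val_inj) /= (modn_small (isT : 1 < N)%N).
have := ltn_ord i; have := ltn_ord j.
case: (ltnP j n.+1) => jn jN iN; first by rewrite modn_small ?addn1 //; lia.
have -> : nat_of_ord j = n.+1 by lia.
by rewrite addn1 modnn; lia.
Qed.

(* Write [shift_mx 1 = L + e_0 e_{n-1}^T] with [L] nilpotent.  Then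
   [1 - L (x) B] is unitriangular with inverse [\sum_k L^k (x) B^k], and
   Sylvester's identity leaves [1 - \sum_k (e_{n-1}^T L^k e_0) B^{k+1}]. *)
Lemma det_kron_shift1 (d : nat) (B : 'M[F]_d) :
  \det (1%:M - kron (shift_mx 1) B) = \det (1%:M - B ^+ N).
Proof.
pose L := kron nilshift_mx B; pose S := \sum_(k < N) L ^+ k.
have LX k : L ^+ k = kron (nilshift_mx ^+ k) (B ^+ k) by rewrite kronX.
have LS : (1%:M - L) *m S = 1%:M.
  have := subrX1 L N; rewrite LX (_ : nilshift_mx ^+ N = 0) ?kron0l => [LN|].
    by apply: oppr_inj; rewrite -mulNmx opprB -[RHS]add0r [RHS]LN.
  apply/matrixP => i j; rewrite nilshift_mxX !mxE.
  by case: eqP => // ij; have := ltn_ord i; lia.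
have detL : \det (1%:M - L) = 1.
  rewrite det_trig.
    apply: big1 => i _; rewrite !mxE eqxx /=.
    by rewrite (_ : (_ == _.+1) = false) ?mul0r ?subr0 //; apply/negbTE; lia.
  apply/is_trig_mxP => i j ij; rewrite !mxE (_ : (i == j) = false).
    have /= := leq_div2r d (ltnW ij).
    by case: eqP => [->|]; rewrite ?ltnn ?mul0r ?subr0.
  by apply/negbTE; rewrite -(inj_eq val_inj) /= neq_ltn ij.
have -> : 1%:M - kron (shift_mx 1) B = (1%:M - L) *m
    (1%:M - S *m kron (delta_mx 0 (0 : 'I_1)) 1%:M *m kron (delta_mx 0 ord_max) B).
  rewrite mulmxBr mulmx1 !mulmxA LS mul1mx mul_kron mul1mx.
  by rewrite shift_mx1E kronDl opprD addrA.
rewrite det_mulmx detL mul1r det_1B_mulC mulmxA.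
have -> : kron (delta_mx 0 ord_max) B *m S *m kron (delta_mx 0 (0 : 'I_1)) 1%:M
    = kron (1%:M : 'M_1) (B ^+ N).
  rewrite mulmx_sumr mulmx_suml (bigD1 ord_max) //= big1 ?addr0 => [|k kn].
    rewrite LX !mul_kron mulmx1 [B *m _](esym (exprS _ _)); congr kron.
    rewrite -rowE -colE; apply/matrixP => i j.
    by rewrite nilshift_mxX !mxE !ord1 eqxx add0n eqxx.
  rewrite LX !mul_kron (_ : _ *m _ *m _ = 0) ?kron0l //.
  rewrite -rowE -colE; apply/matrixP => i j.
  by rewrite nilshift_mxX !mxE add0n (_ : (_ == _) = false) // eq_sym; exact: negbTE.
by rewrite -[kron _ _]scale1r kron1l_cast det_1B_cast scale1r.
Qed.

Lemma scalemxX (d : nat) (c : F) (B : 'M[F]_d) (k : nat) :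
  (c *: B) ^+ k = c ^+ k *: B ^+ k.
Proof.
elim: k => [|k IHk]; first by rewrite !expr0 scale1r.
by rewrite !exprS IHk -!mulmxE -scalemxAl -scalemxAr scalerA.
Qed.

(** Multiplication by [a] permutes ['I_N], with inverse multiplication by [b], and carries
    translation by 1 to translation by [a]. This reduces to [shift_mx 1], and then [B ^+ N = 1]
    leaves a scalar matrix. *)
Lemma det_kron_shift (d : nat) (a b : 'I_N) (B : 'M[F]_d) (c : F) :
  a * b = 1 -> B ^+ N = 1%:M ->
  \det (1%:M - c *: kron (shift_mx a) B) = (1 - c ^+ N) ^+ d.
Proof.
move=> ab1 BN.
have ba : fun_mx ( *%R^~ b) *m fun_mx ( *%R^~ a) = 1%:M.
  rewrite mul_fun_mx -fun_mx_id; apply: eq_fun_mx => j /=.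
  by rewrite -mulrA ab1 mulr1.
have -> : shift_mx a = fun_mx ( *%R^~ a) *m shift_mx 1 *m fun_mx ( *%R^~ b).
  rewrite !mul_fun_mx; apply: eq_fun_mx => j /=.
  by rewrite mulrDl mul1r -mulrA (mulrC b) ab1 mulr1.
rewrite -[B in kron _ B]mulmx1 -mul_kron -[B in kron _ B]mul1mx -mul_kron.
rewrite -mulmxA scalemxAr det_1B_mulC -scalemxAl -mulmxA mul_kron ba mulmx1 kron1 mulmx1.
rewrite -kronZr det_kron_shift1 scalemxX BN scalemx1 -raddfB /=.
exact: det_scalar.
Qed.

(** * The sum-zero hyperplane *)

Definition sum0_incl : 'M[F]_(N, n.+1) := col_mx (const_mx (- 1) : 'rV_ _) 1%:M.
Definition sum0_proj : 'M[F]_(n.+1, N) := row_mx (0 : 'cV_ _) 1%:M.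
(** The action on the hyperplane in the basis [e_(j+1) - e_0], given by the columns of [sum0_incl];
    [sum0_proj] reads coordinates by dropping entry 0. *)
Definition reduced_shift (a : 'I_N) : 'M[F]_n.+1 :=
  sum0_proj *m shift_mx a *m sum0_incl.

Lemma row1_sum0_incl : (const_mx 1 : 'rV[F]_N) *m sum0_incl = 0.
Proof.
rewrite -(@row_mx_const _ 1 1 n.+1) (@mul_row_col _ 1 1 n.+1) mulmx1.
apply/matrixP => i j; rewrite !mxE big_ord1 !mxE mul1r addrC; exact: subrr.
Qed.

Lemma sum0_inclK : sum0_proj *m sum0_incl = 1%:M.
Proof. by rewrite (@mul_row_col _ _ 1 n.+1) mul0mx add0r mulmx1. Qed.

Lemma sum0_decomp :
  sum0_incl *m sum0_proj + col_mx 1%:M 0 *m (const_mx 1 : 'rV[F]_N) = 1%:M.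
Proof.
rewrite -(@row_mx_const _ 1 1 n.+1) !(@mul_col_row _ 1 n.+1 _ 1 n.+1) (@add_block_mx _ 1 n.+1 1 n.+1).
rewrite !mulmx0 !mulmx1 !mul1mx !mul0mx !addr0 add0r (@scalar_mx_block _ 1 n.+1).
by congr (@block_mx _ 1 n.+1 1 n.+1 _ _ _ _); apply/matrixP => i j; rewrite !mxE ?ord1 ?addNr.
Qed.

(** Between the two shifts, [sum0_incl *m sum0_proj] is [1 - e_0 1^T]; the correction vanishes
    because shifts fix [1^T], which kills the hyperplane. *)
Lemma mul_reduced_shift (a b : 'I_N) :
  reduced_shift a *m reduced_shift b = reduced_shift (a + b).
Proof.
rewrite /reduced_shift -!mulmxA (mulmxA sum0_incl) [sum0_incl *m _](canRL (addrK _) sum0_decomp).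
rewrite mulmxBl mul1mx -!mulmxA [const_mx _ *m _]mulmxA mul_const_shift_mx.
by rewrite row1_sum0_incl mulmx0 subr0 [shift_mx a *m _]mulmxA mul_shift_mx.
Qed.

Lemma reduced_shiftX (a : 'I_N) (k : nat) : reduced_shift a ^+ k = reduced_shift (a *+ k).
Proof.
elim: k => [|k IHk].
  by rewrite expr0 mulr0n /reduced_shift shift_mx0 mulmx1 sum0_inclK.
by rewrite exprS IHk mulrS -mul_reduced_shift.
Qed.

Lemma reduced_shift_order (a : 'I_N) : reduced_shift a ^+ N = 1%:M.
Proof.
rewrite reduced_shiftX -mulr_natr Zp_nat (_ : inZp N = 0) ?mulr0.
  by rewrite /reduced_shift shift_mx0 mulmx1 sum0_inclK.
by apply/val_inj; rewrite /= modnn.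
Qed.

(** * Perturbed shifts [t P^a + u 1^T] *)

(** The term [u 1^T] vanishes on the hyperplane, and fixing [1^T] means acting trivially on the
    quotient. The class is stable under products and, for invertible [t], inverses, so it contains
    all integer powers of the Burau matrix when [q] is nonzero. *)
Definition shift_perturb (t : F) (a : 'I_N) (M : 'M[F]_N) : Prop :=
  (const_mx 1 : 'rV_N) *m M = const_mx 1 /\
  exists u : 'cV_N, M = t *: shift_mx a + u *m const_mx 1.

Lemma shift_perturb_mul t t' a a' M M' :
  shift_perturb t a M -> shift_perturb t' a' M' ->
  shift_perturb (t * t') (a + a') (M *m M').
Proof.
move=> [M1 [u Mu]] [M'1 [u' Mu']]; split; first by rewrite mulmxA M1.
exists (t *: shift_mx a *m u' + u).
rewrite {1}Mu [LHS]mulmxDl -(mulmxA u) M'1 Mu' mulmxDr mulmxDl addrA.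
by rewrite -scalemxAl -scalemxAr mul_shift_mx scalerA mulmxA.
Qed.

Lemma shift_perturb1 : shift_perturb 1 0 1%:M.
Proof.
split; first by rewrite mulmx1.
by exists 0; rewrite mul0mx addr0 scale1r shift_mx0.
Qed.

Lemma shift_perturbX t a M (k : nat) :
  shift_perturb t a M -> shift_perturb (t ^+ k) (a *+ k) (M ^+ k).
Proof.
move=> tM; elim: k => [|k IHk]; first exact: shift_perturb1.
by rewrite !exprS mulrS; apply: shift_perturb_mul.
Qed.

Lemma extension_shift_perturb t a M :
  shift_perturb t a M -> extension M (t *: reduced_shift a) (1%:M : 'M_1).
Proof.
move=> [M1 [u Mu]].
exists sum0_incl, (col_mx 1%:M 0 : 'M_(1 + n.+1, 1)), sum0_proj, (const_mx 1).
have vp : (const_mx 1 : 'rV[F]_N) *m (col_mx 1%:M 0 : 'M_(1 + n.+1, 1)) = 1%:M.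
  rewrite -(@row_mx_const _ 1 1 n.+1) (@mul_row_col _ 1 1 n.+1) mulmx1 mulmx0 addr0.
  by apply/matrixP => i j; rewrite !mxE !ord1.
split; last by rewrite M1 vp.
- split; [exact: sum0_decomp | exact: sum0_inclK | exact: vp | | exact: row1_sum0_incl].
  by rewrite (@mul_row_col _ _ 1 n.+1) mul0mx mulmx0 addr0.
- by rewrite M1 row1_sum0_incl.
rewrite Mu mulmxDr mulmxDl -scalemxAr -scalemxAl mulmxA -(mulmxA _ _ sum0_incl).
by rewrite row1_sum0_incl mulmx0 addr0.
Qed.

Lemma shift_perturb_shift a : shift_perturb 1 a (shift_mx a).
Proof.
split; first exact: mul_const_shift_mx.
by exists 0; rewrite mul0mx addr0 scale1r.
Qed.

(** * The product of the Burau generators *)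

Lemma mul_burau_genE (A : 'M[F]_N) (q : F) (k : nat) (kN : (k.+1 < N)%N) i j :
  (A *m burau_gen N q k) i j =
  if j == k :> nat then A i j * (1 - q) + A i (Ordinal kN) * q
  else if j == k.+1 :> nat then A i (Ordinal (ltnW kN)) else A i j.
Proof.
set k1 := Ordinal kN; set k0 := Ordinal (ltnW kN).
have kS : (k.+1 == k) = false by lia.
have Sk : (k == k.+1) = false by lia.
have k01 : k1 != k0 by rewrite -(inj_eq val_inj) /= kS.
rewrite mxE; case: (j =P k :> nat) => [jk|/eqP jk].
  have -> : j = k0 by apply: val_inj.
  rewrite (bigD1 k0) //= (bigD1 k1) //= !mxE /= !eqxx kS ?Sk /=.
  rewrite big1 ?addr0 // => l /andP[lk0 lk1]; rewrite mxE /=.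
  move: lk0 lk1; rewrite -!(inj_eq val_inj) /= => /negPf -> /negPf ->.
  by rewrite mulr0.
case: (j =P k.+1 :> nat) => [jk1|/eqP jk1].
  have -> : j = k1 by apply: val_inj.
  rewrite (bigD1 k0) //= !mxE /= !eqxx kS ?Sk /=.
  rewrite mulr1 big1 ?addr0 // => l; rewrite mxE /= -!(inj_eq val_inj) /=.
  by move=> /negPf ->; rewrite kS !andbF eqxx andbT /=; case: eqP; rewrite mulr0.
rewrite (bigD1 j) //= !mxE (negPf jk) (negPf jk1) !andbF eqxx mulr1 big1 ?addr0 //.
by move=> l /negPf lj; rewrite mxE (negPf jk) (negPf jk1) !andbF lj mulr0.
Qed.

(** Each new generator turns column [k], equal to [e_0], into [(1-q) e_0 + q e_(k+1)] and moves
    [e_0] to column [k+1]. *)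
Lemma burau_prefixE (q : F) (k : nat) : (k < N)%N ->
  \prod_(i < k) burau_gen N q i
  = \matrix_(i, j) if (j < k)%N then (1 - q) *+ (i == 0) + q *+ (i == j.+1 :> nat)
                   else if (j == k :> nat) then (i == 0)%:R else (i == j)%:R.
Proof.
elim: k => [_|k IHk kN].
  rewrite big_ord0; apply/matrixP => i j; rewrite !mxE /=.
  by case: ifP => // /eqP j0; rewrite -!(inj_eq val_inj) /= j0.
rewrite big_ord_recr /= IHk ?(ltnW kN) //; apply/matrixP => i j.
rewrite mul_burau_genE !mxE /= ltnS.
case: (ltngtP j k) => jk /=.
- by rewrite (_ : (j == k.+1 :> nat) = false) //; lia.
- by rewrite ltnn eqxx.
have [Sk kS] : (k.+1 < k)%N = false /\ (k.+1 == k) = false by lia.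
rewrite jk Sk kS.
by rewrite -(inj_eq val_inj) /= mulr_natl mulr_natl.
Qed.

Lemma shift_perturb_burau_delta (q : F) : shift_perturb q 1 (burau_delta N q).
Proof.
have E : burau_delta N q = q *: shift_mx 1 + ((1 - q) *: delta_mx 0 0 : 'cV_N) *m const_mx 1.
  rewrite /burau_delta burau_prefixE //; apply/matrixP => i j.
  rewrite !mxE big_ord1 !mxE eqxx andbT mulr1 !mulr_natr -!(inj_eq val_inj) /=.
  rewrite (modn_small (isT : 1 < N)%N) addn1 addrC ltnS.
  have [jn|jn] := ltnP j n.+1; first by rewrite modn_small // -ltnS jn.
  (* In the last column the shift wraps around, and [(1-q) e_0 + q e_0 = e_0] is the column left
     over in the prefix formula. *)
  have -> : nat_of_ord j = n.+1 by have := ltn_ord j; lia.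
  by rewrite ltnn eqxx modnn -mulrnDl subrK.
split; last by exists ((1 - q) *: delta_mx 0 0).
rewrite E mulmxDr -scalemxAr mul_const_shift_mx mulmxA -!scalemxAr -colE.
by apply/matrixP => i j; rewrite !mxE big_ord1 !mxE !mulr1 subrKC.
Qed.

Lemma shift_perturb_inv (t t' : F) a M : t * t' = 1 -> shift_perturb t a M ->
  exists2 M', M *m M' = 1%:M & shift_perturb t' (- a) M'.
Proof.
move=> tt' [M1 [u Mu]].
(* In scalar terms, [t + 1^T u = 1]. *)
have t1u : t *: const_mx 1 + (const_mx 1 *m u) *m const_mx 1 = const_mx 1 :> 'rV_N.
  by rewrite -[RHS]M1 Mu mulmxDr -scalemxAr mul_const_shift_mx mulmxA.
(* If [M M' = 1] and [1^T M' = 1^T], then [t P^a M' = 1 - u 1^T], which forces this choice. *)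
pose M' := t' *: (shift_mx (- a) *m (1%:M - u *m const_mx 1)).
have M'1 : (const_mx 1 : 'rV_N) *m M' = const_mx 1.
  rewrite -scalemxAr mulmxA mul_const_shift_mx mulmxBr mulmx1 mulmxA.
  by rewrite -{1}t1u addrK scalerA mulrC tt' scale1r.
exists M'; last first.
  split=> //; exists (- (t' *: (shift_mx (- a) *m u))).
  by rewrite /M' mulNmx -scalemxAl -scalerBr mulmxBr mulmx1 mulmxA.
rewrite Mu mulmxDl -(mulmxA u) M'1 -scalemxAl -scalemxAr scalerA tt' scale1r.
by rewrite mulmxA mul_shift_mx subrr shift_mx0 mul1mx subrK.
Qed.

End Shift.

(** * Determinants of Burau powers and of their tensor powers *)

Section Burau.
Set Implicit Arguments.
Unset Strict Implicit.
Unset Printing Implicit Defensive.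
Variables (F : fieldType) (n : nat).
Local Notation N := n.+2.

Lemma shift_perturb_burau_sigma (q : F) (m : int) :
  q != 0 -> shift_perturb (q ^ m) (m%:~R) (burau_sigma N q m).
Proof.
move=> q0; have dq := shift_perturb_burau_delta n q.
case: m => k; first exact: shift_perturbX.
have [D' dD' D'q] := shift_perturb_inv (mulfV q0) dq.
have [dU _] := mulmx1_unit dD'.
have /= -> : invmx (burau_delta N q) = D'.
  by rewrite -[RHS](mulKmx dU) dD' mulmx1.
have := shift_perturbX k.+1 D'q.
by rewrite NegzE mulrNz mulNrn exprVn.
Qed.

(** This is [h_j c] of the overview, with [V] the reduced shift by [a]. *)
Definition zeta_factor (a : 'I_N) (j : nat) (c : F) : F :=
  \det (1%:M - c *: kron_iter (reduced_shift F a) j (1%:M : 'M_1)).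

Lemma zeta_factor0 a c : zeta_factor a 0 c = 1 - c.
Proof. by rewrite /zeta_factor /= scalemx1 -raddfB /= det_scalar1. Qed.

Lemma zeta_factor_step (a b : 'I_N) (j : nat) (c : F) : a * b = 1 ->
  zeta_factor a j.+1 c * zeta_factor a j c = (1 - c ^+ N) ^+ (n.+1 ^ j).
Proof.
move=> ab1; rewrite /zeta_factor.
have [e ->] := kron_iterSr (reduced_shift F a) j (1%:M : 'M_1).
rewrite det_1B_cast.
(* Read backwards, the splitting of [shift_mx a] merges the two determinants into that of
   [shift_mx a] tensored with [V^{(x)j}]. *)
have := extension_shift_perturb (shift_perturb_shift F a).
rewrite scale1r => /extension_kron1 /extension_det <-.
rewrite (det_kron_shift _ ab1) ?kron_iter_dimE ?muln1 //.
by rewrite kron_iterX reduced_shift_order expr1n kron_iter1.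
Qed.

Lemma det_burau_kron (q s : F) (m : int) (r : nat) : q != 0 ->
  \det (1%:M - s *: kron_pow (burau_sigma N q m) r) =
  \prod_(l < r.+1) zeta_factor (m%:~R) l (q ^ (l%:Z * m) * s) ^+ 'C(r, l).
Proof.
move=> q0.
have := extension_shift_perturb (shift_perturb_burau_sigma m q0).
move/(det_kron_pow s 0 r) => /= ->; apply: eq_bigr => i _.
rewrite add0n kron_iter_scalel scalerA /zeta_factor.
by rewrite mulrC (mulrC i%:Z) -exprz_exp.
Qed.

Lemma det_burau (q s : F) (m : int) : q != 0 ->
  \det (1%:M - s *: burau_sigma N q m) = (1 - s) * zeta_factor (m%:~R) 1 (q ^ m * s).
Proof.
move=> q0; have := det_burau_kron s m 1 q0.
rewrite [kron_pow _ 1]/= castmx_id kron1r_cast !det_1B_cast => ->.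
by rewrite big_ord_recl big_ord1 lift0 zeta_factor0 bin0 binn !expr1 mul0r expr0z !mul1r.
Qed.

End Burau.

(** * Closed form of the factors *)

Section Closed_form.
Set Implicit Arguments.
Unset Strict Implicit.
Unset Printing Implicit Defensive.

Lemma intr_unit_Zp (n : nat) (m : int) :
  coprime n.+2 `|m| -> exists b : 'I_n.+2, m%:~R * b = 1.
Proof.
move=> nm; have mU : (m%:~R : 'I_n.+2) \is a GRing.unit.
  have absU : (`|m|%:R : 'I_n.+2) \is a GRing.unit.
    by have := unitZpE `|m| (isT : 1 < n.+2)%N; rewrite nm.
  by case: m absU nm => k //= kU _; rewrite NegzE mulrNz unitrN.
by exists (m%:~R)^-1; rewrite mulrV.
Qed.

(** The exponent of [1 - c^n] in [h_l c]; [b_coef r l n] is ['C(r, l)] times it. *)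
Definition exp_coef (n l : nat) : int := (((n%:Z - 1) ^+ l - (-1) ^+ l) %/ n%:Z)%Z.

Lemma exp_coef0 (n : nat) : exp_coef n 0 = 0.
Proof. by rewrite /exp_coef !expr0 subrr div0z. Qed.

(** The additive counterpart of [zeta_factor_step]. The integer division is exact because [n - (-1)]
    divides [n^l - (-1)^l]. *)
Lemma exp_coefS (n l : nat) :
  exp_coef n.+1 l.+1 = (n ^ l)%:Z - exp_coef n.+1 l.
Proof.
rewrite /exp_coef (_ : n.+1%:Z - 1 = n%:Z); last by lia.
have xE : n%:Z - -1 = n.+1%:Z by lia.
rewrite [X in (X %/ _)%Z](_ : _ = ((n ^ l)%:Z - ((n%:Z ^+ l - (-1) ^+ l) %/ n.+1%:Z)%Z) * n.+1%:Z).
  by rewrite mulzK.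
rewrite mulrBl divzK; last by rewrite subrXX xE; apply: dvdz_mulr.
rewrite !exprS -xE -[(n ^ l)%N%:Z]natz natrX natz; ring.
Qed.

Variables (F : fieldType) (n : nat).
Local Notation N := n.+2.

Lemma zeta_factor_neq0 (a b : 'I_N) (j : nat) (c : F) :
  a * b = 1 -> 1 - c ^+ N != 0 -> zeta_factor a j c != 0.
Proof.
move=> ab1 cN; have := expf_neq0 (n.+1 ^ j)%N cN.
by rewrite -(zeta_factor_step _ _ ab1) mulf_eq0 negb_or => /andP[].
Qed.

Lemma zeta_factorE (a b : 'I_N) (j : nat) (c : F) :
  a * b = 1 -> 1 - c ^+ N != 0 -> 1 - c != 0 ->
  zeta_factor a j c = (1 - c) ^ ((-1) ^+ j) * (1 - c ^+ N) ^ exp_coef N j.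
Proof.
move=> ab1 cN c1; elim: j => [|j IHj].
  by rewrite zeta_factor0 exp_coef0 expr0 expr0z expr1z mulr1.
(* After multiplication by [h_j c], the powers of [1 - c] cancel and the exponents of [1 - c^N] add
   up to [(n+1)^j]. *)
apply: (mulIf (zeta_factor_neq0 j ab1 cN)).
rewrite (zeta_factor_step _ _ ab1) IHj mulrACA -!expfzDr //.
by rewrite exp_coefS subrK [(-1) ^+ _]exprS mulN1r addNr expr0z mul1r.
Qed.

Lemma exprz_sum (I : Type) (t : seq I) (x : F) (f : I -> int) : x != 0 ->
  x ^ (\sum_(i <- t) f i) = \prod_(i <- t) x ^ f i.
Proof. by move=> x0; elim/big_rec2: _ => // i y z _ <-; rewrite expfzDr. Qed.

(** The term [l] of the final identity, for [x = 1 - s], [y = 1 - c^N], [z = 1 - c], [A = (-1)^l],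
    [E = exp_coef N l] and [k = 'C(r, l)]; then [x * y / z] is the Burau determinant for [l * m]. *)
Lemma factor_rearrange (x y z : F) (A E : int) (k : nat) :
  x != 0 -> y != 0 -> z != 0 ->
  x ^ (k%:Z * A) / (z ^ A * y ^ E) ^+ k
  = (x / z) ^ (k%:Z * A + k%:Z * E) * (x * y / z)^-1 ^ (k%:Z * E).
Proof.
move=> x0 y0 z0; rewrite -[_ ^+ k]/(_ ^ k%:Z) !expfzDr ?mulf_neq0 ?invr_neq0 //.
rewrite !invfM !invrK !expfzMl -!expfV !exprz_exp !(mulrC _ k%:Z).
by field; rewrite !expfz_neq0.
Qed.

End Closed_form.

(** * Assembly of the product formula *)

Theorem theorem3p2 (F : fieldType) (n : nat) (m : int) (r : nat) (q s : F) :
  (2 <= n)%N -> (1 <= r)%N -> coprime n (r`! * `|m|) ->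
  q != 0 ->
  1 - s != 0 ->
  (forall l : nat, (1 <= l <= r)%N -> 1 - q ^ (l%:Z * m) * s != 0) ->
  \det (1%:M - s *: kron_pow (burau_sigma n q m) r) != 0 ->
  (forall l : nat, (1 <= l <= r)%N ->
     \det (1%:M - s *: burau_sigma n q (l%:Z * m)) != 0) ->
  zeta s (kron_pow (burau_sigma n q m) r)
  = K_fun n m r s q *
    \prod_(1 <= l < r.+1) zeta s (burau_sigma n q (l%:Z * m)) ^ b_coef r l n.
Proof.
case: n => [|[|n]] // _ r1 nrm q0 s1 cs1 _ dets.
have [nr nm] : coprime n.+2 r`! /\ coprime n.+2 `|m|.
  by apply/andP; rewrite -coprimeMr.
(* Each [l <= r] divides [r!], hence is prime to [n]; so the shift by [l * m] is also conjugate to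
   the basic one. *)
have coprime_lm l : (1 <= l <= r)%N -> coprime n.+2 `|l%:Z * m|.
  move=> lr; rewrite abszM coprimeMr nm andbT; apply: coprime_dvdr nr.
  by apply: dvdn_fact.
have [b mb] := intr_unit_Zp nm.
pose c l : F := q ^ (l%:Z * m) * s.
(* The determinant is [(1 - s) h_1], and [1 - c l] is [h_0], so the recursion at [j = 0] applies. *)
have detE l : (1 <= l <= r)%N ->
    \det (1%:M - s *: burau_sigma n.+2 q (l%:Z * m)) * (1 - c l)
    = (1 - s) * (1 - c l ^+ n.+2).
  move=> lr; have [b' lmb'] := intr_unit_Zp (coprime_lm l lr).
  rewrite det_burau // -mulrA -/(c l) -(zeta_factor0 ((l%:Z * m)%:~R : 'I_n.+2) (c l)).
  by rewrite (zeta_factor_step _ _ lmb') expn0 expr1.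
have cN l : (1 <= l <= r)%N -> 1 - c l ^+ n.+2 != 0.
  move=> lr; have := mulf_neq0 (dets l lr) (cs1 l lr).
  by rewrite detE // mulf_eq0 negb_or => /andP[].
rewrite /zeta det_burau_kron // big_ord_recl bin0 expr1 mul0r expr0z mul1r zeta_factor0.
rewrite big_add1 /K_fun big_add1 /= !big_mkord -big_split /=.
(* Expanding [(1 - 1)^r = 0], where [r >= 1], lets the [l = 0] factor [(1 - s)^-1] be spread over
   the factors [l >= 1]. *)
have sum_a : \sum_(l < r) a_coef r l.+1 = -1.
  have := exprDn (1 : int) (-1) r; rewrite subrr expr0n (gtn_eqF r1) big_ord_recl.
  rewrite expr1n bin0 mulr1 => /esym/eqP; rewrite addrC addr_eq0 => /eqP <-.
  by apply: eq_bigr => l _; rewrite lift0 expr1n mul1r /a_coef -mulr_natl natz.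
have s1E : (1 - s)^-1 = \prod_(l < r) (1 - s) ^ a_coef r l.+1.
  by rewrite -exprz_sum // sum_a.
rewrite invfM s1E -prodfV -big_split; apply: eq_bigr => l _ /=.
rewrite /bump add1n.
have lr : (1 <= l.+1 <= r)%N by rewrite /= ltn_ord.
rewrite -/(c l.+1) (zeta_factorE _ mb (cN _ lr) (cs1 _ lr)).
have -> : \det (1%:M - s *: burau_sigma n.+2 q (l.+1%:Z * m))
    = (1 - s) * (1 - c l.+1 ^+ n.+2) / (1 - c l.+1).
  by rewrite -detE // mulfK // cs1.
have /= cl := cs1 _ lr; rewrite -/(c l.+1) in cl.
have := cN _ lr; move: (1 - _ ^+ _) => y y0.
rewrite (_ : b_coef r l.+1 n.+2 = 'C(r, l.+1)%:Z * exp_coef n.+2 l.+1) // /a_coef.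
by apply: factor_rearrange.
Qed.
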